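(* For all even integers $m\geq 2$, $$\int_0^{\infty } \frac{x \log \left(x^{3m}+1\right)}{x^3+1}\,dx=\frac{\pi^2m}{9}-\frac{\pi m\sqrt{3}}{9}\log 2+\frac{2\pi\sqrt{3}}{9}\sum _{k=0}^{\frac{m-2}{2}} \Bigg\{\log (\varphi_k+1)-2 \log \left[\sin \left(\frac{1}{3} \sin ^{-1}\sqrt{\frac{\varphi_k+1}{2}}\right)\right]+\log \left[2 \cos \left(\frac{2}{3} \sin ^{-1}\sqrt{\frac{\varphi_k+1}{2}}\right)+1\right]\Bigg\},$$ and for all odd integers $m\geq 1$, $$\int_0^{\infty } \frac{x \log \left(x^{3m}+1\right)}{x^3+1}\,dx=\frac{\pi^2m}{9}+\frac{\pi \sqrt{3}}{3}\log 3-\frac{\pi(m-1)\sqrt{3}}{9}\log 2+\frac{2\pi\sqrt{3}}{9}\sum _{k=0}^{\frac{m-3}{2}} \Bigg\{\log(\varphi_k+1)-2 \log \left[\sin \left(\frac{1}{3} \sin ^{-1}\sqrt{\frac{\varphi_k+1}{2}}\right)\right]+\log \left[2 \cos \left(\frac{2}{3} \sin ^{-1}\sqrt{\frac{\varphi_k+1}{2}}\right)+1\right]\Bigg\}.$$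
   Context: For given $m$, $\varphi_k=\cos\left(\frac{(2k+1)\pi}{m}\right)$. $\sin^{-1}$ denotes the (principal) inverse sine. An empty sum $\sum_{k=0}^{-1}(\cdot)$ is taken to be zero. *)

(* Defs.v *)
From HB Require Import structures.
From mathcomp Require Import all_boot all_order all_algebra.
From mathcomp Require Import all_classical all_reals all_analysis.
Set Implicit Arguments.
Unset Strict Implicit.
Unset Printing Implicit Defensive.
Import Order.TTheory GRing.Theory Num.Theory.
Import numFieldNormedType.Exports.
Local Open Scope classical_set_scope.
Local Open Scope ring_scope.

Definition varphi (R : realType) (m k : nat) : R :=
  cos ((2 * k + 1)%:R * pi / m%:R).

Definition summand (R : realType) (m k : nat) : R :=
  let a := asin (Num.sqrt ((varphi R m k + 1) / 2)) in
  ln (varphi R m k + 1) - 2 * ln (sin (1 / 3 * a))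
    + ln (2 * cos (2 / 3 * a) + 1).

(* Main.v *)
(* Over the reals, (y^m + 1)^2 is the product of the y^2 - 2 phi_k y + 1 for
   k < m, so after pairing k with m-1-k the integral is a sum of integrals
     I(a) = int_0^oo x ln (x^6 + 2 (cos a) x^3 + 1) / (x^3 + 1) dx
   with a = pi - (2k+1) pi / m, plus I(0)/2 when m is odd.  Everything then
   follows from
     I(a) = 2 pi^2 / 9 + (2 pi / sqrt 3) ln (1 + 2 cos (a / 3)),  0 <= a < pi,
   since the summand of index k equals ln 2 + 3 ln (1 + 2 cos (a / 3)) by the
   triple angle formula for the sine.
   For a = 0, write ln (1 + x^3) as the integral of 3 s^2 x^3 / (1 + s^3 x^3)
   over 0 < s < 1; for a > 0, write 2 ln (1 + x^3) - ln (x^6 + 2 (cos a) x^3 + 1)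
   as the integral of 2 (sin b) x^3 / (x^6 + 2 (cos b) x^3 + 1) over 0 < b < a.
   These kernels are nonnegative, so Tonelli's theorem applies, and the inner
   integral in x is that of a rational function with an explicit primitive. *)
Require Import Defs.
From mathcomp Require Import all_boot all_order all_algebra.
From mathcomp Require Import all_classical all_reals all_analysis.
From mathcomp Require Import measurable_realfun.
From mathcomp Require Import ring lra zify.
Import Order.TTheory GRing.Theory Num.Theory.
Import numFieldNormedType.Exports.
Local Open Scope classical_set_scope.
Local Open Scope ring_scope.

(** * Primitives of rational functions *)

Section primitives.
Context {R : realType}.
Implicit Types (f h F : R -> R) (a b c d g r s v x : R).

(** For real x this is the squared modulus of x + exp(i g). *)
Definition quad g x := x ^+ 2 + 2 * cos g * x + 1.

Lemma cos_gtN1 {g} : 0 <= g < pi -> -1 < cos g.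
Proof.
move=> /andP[g0 gpi]; rewrite -cospi ltr_cos ?in_itv/= ?gpi ?g0 ?lexx ?pi_ge0//.
exact: ltW.
Qed.

(** Complete the square according to the sign of x: (x - 1)^2 + 2 (cos g + 1) x if x >= 0, and (x +
    1)^2 + 2 (1 - cos g) (- x) if x < 0. At g = 0 the quadratic is (x + 1)^2, which vanishes at
    -1. *)
Lemma quad_gt0 {g x} : 0 <= g < pi -> -1 < x -> 0 < quad g x.
Proof.
move=> /cos_gtN1 cg x1; rewrite /quad; have c1 := cos_le1 g.
have [x0|x0] := leP 0 x.
  have -> : x ^+ 2 + 2 * cos g * x + 1 =
    (x - 1) ^+ 2 + 2 * ((cos g + 1) * x) by ring.
  move: x0; rewrite le_eqVlt => /predU1P[<-|x0].
    by rewrite mulr0 mulr0 addr0 sub0r sqrrN expr1n.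
  by rewrite ltr_wpDl ?sqr_ge0// mulr_gt0// mulr_gt0//; lra.
have -> : x ^+ 2 + 2 * cos g * x + 1 =
  (x + 1) ^+ 2 + 2 * ((1 - cos g) * (- x)) by ring.
by rewrite ltr_pwDl ?exprn_gt0 ?mulr_ge0//; lra.
Qed.

Lemma ltW_itv {g} : 0 < g < pi -> 0 <= g < pi.
Proof. by move=> /andP[/ltW-> ->]. Qed.

Lemma is_derive_quad g x : is_derive x 1 (quad g) (2 * (x + cos g)).
Proof.
rewrite /quad; apply: is_derive_eq.
by rewrite /GRing.scale/=; ring.
Qed.

Lemma continuous_quad g : continuous (quad g).
Proof.
move=> x; apply: differentiable_continuous; apply/derivable1_diffP.
by have := is_derive_quad g x => d; exact: ex_derive.
Qed.

(* [v] is the integral of [f] over [0, +oo[ once the divergence [a * ln x] is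
   discarded.  The domain ]-1, +oo[ makes continuity and differentiability at 0
   two-sided. *)
Definition log_primitive f a v := exists F,
  [/\ forall x, -1 < x -> {for x, continuous f},
      forall x, -1 < x -> is_derive x 1 F (f x) &
      F x - a * ln x @[x --> +oo] --> F 0 + v].

Lemma log_primitiveD {f1 f2 a1 a2 v1 v2} :
  log_primitive f1 a1 v1 -> log_primitive f2 a2 v2 ->
  log_primitive (fun x => f1 x + f2 x) (a1 + a2) (v1 + v2).
Proof.
move=> [F1 [c1 d1 l1]] [F2 [c2 d2 l2]]; exists (fun x => F1 x + F2 x); split.
- by move=> x x0; apply: cvgD; [exact: c1|exact: c2].
- by move=> x x0; apply: is_deriveD; [exact: d1|exact: d2].
- have -> : F1 0 + F2 0 + (v1 + v2) = (F1 0 + v1) + (F2 0 + v2) by ring.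
  under eq_cvg do rewrite mulrDl opprD addrACA.
  exact: cvgD.
Qed.

Lemma log_primitiveZ c {f a v} :
  log_primitive f a v -> log_primitive (fun x => c * f x) (c * a) (c * v).
Proof.
move=> [F [cf dF l]]; exists (fun x => c * F x); split.
- by move=> x x0; apply: cvgM; [exact: cvg_cst|exact: cf].
- move=> x x0; have := dF x x0 => dFx; exact: is_deriveZ.
- under eq_cvg do rewrite -mulrA -mulrBr.
  rewrite -mulrDr; exact: cvgMr.
Qed.

Lemma log_primitive_ext {f h a v} : log_primitive f a v ->
  (forall x, -1 < x -> h x = f x) -> log_primitive h a v.
Proof.
move=> [F [cf dF l]] fh; exists F; split => //.
- move=> x x1; rewrite /prop_for /continuous_at fh//.
  apply: cvg_trans (cf x x1); apply: near_eq_cvg.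
  near=> y; rewrite fh//; near: y; exact: lt_nbhsr.
- by move=> x x0; rewrite fh//; exact: dF.
Unshelve. all: by end_near. Qed.

(** Substitution of r x for x. The bound r <= 1 keeps r x in ]-1, +oo[; a logarithmic coefficient a
    would add a ln r to the value, hence the coefficient 0. *)
Lemma log_primitive_dilate {f v r} : 0 < r <= 1 -> log_primitive f 0 v ->
  log_primitive (fun x => r * f (r * x)) 0 v.
Proof.
move=> /andP[r0 r1] [F [cf dF l]].
have rN1 x : -1 < x -> -1 < r * x by nra.
have dr x : is_derive x 1 (fun y => r * y) r.
  by apply: is_derive_eq; rewrite /GRing.scale/= ; ring.
exists (fun x => F (r * x)); split.
- move=> x /rN1 x1; apply: cvgMr.
  apply: (cvg_comp (fun y => r * y) f); last exact: cf.
  exact: cvgMr.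
- move=> x /rN1 x1; have := dF _ x1 => dFx.
  by rewrite mulrC; exact: (is_derive1_comp (f := F) (g := fun y => r * y)).
- have {}l : F x @[x --> +oo] --> F 0 + v.
    by move: l; under eq_cvg do rewrite mul0r subr0.
  under eq_cvg do rewrite mul0r subr0.
  rewrite mulr0; apply: (cvg_comp (fun y => r * y) F) l.
  by apply: gt0_cvgMry => //; exact: cvg_id.
Qed.

Lemma integral_log_primitive f v : (forall x, 0 <= x -> 0 <= f x) ->
  log_primitive f 0 v ->
  (\int[lebesgue_measure]_(x in `[0%R, +oo[) (f x)%:E = v%:E)%E.
Proof.
move=> f0 [F [cf dF l]].
have cf' : {within `[0, +oo[, continuous f}.
  apply: continuous_in_subspaceT => x; rewrite inE/= in_itv/= andbT => x0.
  by apply: cf; lra.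
rewrite (ge0_continuous_FTC2y (F := F) (l := F 0 + v) f0 cf').
- by rewrite -EFinB addrAC subrr add0r.
- by move: l; under eq_cvg do rewrite mul0r subr0.
- move=> x x0; have x1 : -1 < x by lra.
  by have := dF x x1 => dFx; exact: ex_derive.
- apply: cvg_at_right_filter.
  apply: differentiable_continuous; apply/derivable1_diffP.
  have x1 : -1 < 0 :> R by lra.
  by have := dF 0 x1 => dFx; exact: ex_derive.
- move=> x; rewrite in_itv/= andbT => x0; rewrite derive1E.
  have x1 : -1 < x by lra.
  by have := dF x x1 => dFx; exact: derive_val.
Qed.

(** The primitive is ln (quad g x): it is 0 at 0, and after subtraction of 2 ln x it becomes ln
    (quad g x / x^2), which tends to 0. *)
Lemma log_primitive_log {g} : 0 <= g < pi ->
  log_primitive (fun x => 2 * (x + cos g) / quad g x) 2 0.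
Proof.
move=> g0; exists (fun x => ln (quad g x)); split.
- move=> x x1; have q0 := quad_gt0 g0 x1.
  apply: cvgM; first by apply: cvgMr; apply: cvgD; [exact: cvg_id|exact: cvg_cst].
  by apply: cvgV; [rewrite gt_eqF|exact: continuous_quad].
- move=> x x1; have q0 := quad_gt0 g0 x1.
  rewrite mulrC; have := is_derive_quad g x => dq; have dl := is_derive1_ln q0.
  exact: (is_derive1_comp (f := @ln R) (g := quad g)).
- rewrite {2}/quad mulr0 expr0n/= !add0r ln1 addr0.
  have : ln (quad g x / x ^+ 2) @[x --> +oo] --> (0 : R).
    rewrite -ln1; apply: (cvg_comp (fun x => quad g x / x ^+ 2) (@ln R));
      last exact: continuous_ln.
    have i0 : (x^-1 : R) @[x --> +oo] --> (0 : R).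
      apply/(gtr0_cvgV0 (f := id)); last exact: cvg_id.
      exact: nbhs_pinfty_gt.
    have -> : (1 : R) = 1 + 2 * cos g * 0 + 0 ^+ 2 by ring.
    have : 1 + 2 * cos g * x^-1 + x^-1 ^+ 2 @[x --> +oo] -->
        (1 + 2 * cos g * 0 + 0 ^+ 2 : R).
      apply: cvgD; last by apply: cvgM.
      by apply: cvgD; [exact: cvg_cst|exact: cvgMr].
    apply: cvg_trans; apply: near_eq_cvg; near=> x.
    have x0 : 0 < x by near: x; exact: nbhs_pinfty_gt.
    by rewrite /quad; field; rewrite gt_eqF.
  apply: cvg_trans; apply: near_eq_cvg; near=> x.
  have x0 : 0 < x by near: x; exact: nbhs_pinfty_gt.
  have x1 : -1 < x by apply: lt_trans x0.
  rewrite ln_div ?posrE ?exprn_gt0// ?quad_gt0//.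
  by rewrite lnXn// mulr_natl.
Unshelve. all: by end_near. Qed.

(** Since quad g x = (x + cos g)^2 + (sin g)^2, a primitive is atan ((x + cos g) / sin g), which
    rises from pi / 2 - g at 0 to pi / 2 at infinity. *)
Lemma log_primitive_atan {g} : 0 < g < pi ->
  log_primitive (fun x => sin g / quad g x) 0 g.
Proof.
move=> /andP[g0 gpi].
have g1 : 0 <= g < pi by rewrite ltW.
have sg : 0 < sin g by rewrite sin_gt0_pi// g0.
exists (fun x => atan ((x + cos g) / sin g)); split.
- move=> x x1; have q0 := quad_gt0 g1 x1.
  apply: cvgMr.
  by apply: cvgV; [rewrite gt_eqF|exact: continuous_quad].
- move=> x x1; have q0 := quad_gt0 g1 x1.
  have dl : is_derive x 1 (fun y => (y + cos g) / sin g) ((sin g)^-1).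
    by apply: is_derive_eq; rewrite /GRing.scale/=; ring.
  have -> : sin g / quad g x = (1 + ((x + cos g) / sin g) ^+ 2)^-1 * (sin g)^-1.
    have e : quad g x = sin g ^+ 2 + (x + cos g) ^+ 2.
      by rewrite /quad sin2cos2; ring.
    rewrite e; field; rewrite -e !gt_eqF//=.
  exact: (is_derive1_comp (f := @atan R) (g := fun y => (y + cos g) / sin g)).
- under eq_cvg do rewrite mul0r subr0.
  have -> : (0 + cos g) / sin g = tan (pi / 2 - g).
    by rewrite /tan sinB cosB sin_pihalf cos_pihalf !mul1r !mul0r subr0 !add0r.
  rewrite tanK ?in_itv/=; last by lra.
  rewrite subrK.
  apply: (cvg_comp (fun x => (x + cos g) / sin g) (@atan R)) (@cvgy_atan R).
  by apply: gt0_cvgMly; [rewrite invr_gt0|exact: cvg_addrr].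
Qed.

(** * Multiple angles, values at pi / 3, and partial fractions over [quad] *)

Lemma cos_mulr2 x : cos (2 * x) = 2 * cos x ^+ 2 - 1.
Proof. by rewrite mulr_natl cos_mulr2n mulr_natl. Qed.

Lemma sin_mulr2 x : sin (2 * x) = 2 * (sin x * cos x).
Proof. by rewrite mulr_natl sin_mulr2n mulr_natl mulrC. Qed.

Lemma cos_mulr3 x : cos (3 * x) = 4 * cos x ^+ 3 - 3 * cos x.
Proof.
have -> : 3 * x = 2 * x + x by ring.
rewrite cosD cos_mulr2 sin_mulr2.
have s2 := sin2cos2 x.
by ring: s2.
Qed.

Lemma sin_mulr3 x : sin (3 * x) = 3 * sin x - 4 * sin x ^+ 3.
Proof.
have -> : 3 * x = 2 * x + x by ring.
rewrite sinD cos_mulr2 sin_mulr2.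
have c2 := cos2sin2 x.
by ring: c2.
Qed.

Lemma cos_pi3 : cos (pi / 3) = 2^-1 :> R.
Proof.
have pi0 := @pi_gt0 R.
have c0 : 0 < cos (pi / 3 : R) by rewrite cos_gt0_pihalf//; lra.
have := cos_mulr3 (pi / 3); rewrite mulrC divfK// cospi => e.
(* The triple angle formula at pi / 3 reads 4 c^3 - 3 c = -1, a cubic with the double root 1 / 2 and
   the negative root -1. *)
have : (cos (pi / 3 : R) + 1) * (2 * cos (pi / 3) - 1) ^+ 2 = 0.
  by transitivity (4 * cos (pi / 3 : R) ^+ 3 - 3 * cos (pi / 3) + 1);
    [ring|rewrite -e addNr].
move/eqP; rewrite mulf_eq0 gt_eqF ?sqrf_eq0/=; last by lra.
by move/eqP=> ?; lra.
Qed.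

Lemma sin_pi3 : sin (pi / 3) = Num.sqrt 3 / 2 :> R.
Proof.
have pi0 := @pi_gt0 R.
have s0 : 0 < sin (pi / 3 : R) by rewrite sin_gt0_pi//; lra.
have w0 : (0:R) < Num.sqrt 3 by rewrite sqrtr_gt0.
apply/eqP; rewrite -(@eqrXn2 _ 2) ?ltW ?divr_gt0//.
rewrite sin2cos2 cos_pi3 exprMn sqr_sqrtr//; by apply/eqP; field.
Qed.

Lemma cos_2pi3 : cos (2 * pi / 3) = - 2^-1 :> R.
Proof. by rewrite -mulrA cos_mulr2 cos_pi3; field. Qed.

Lemma sin_2pi3 : sin (2 * pi / 3) = Num.sqrt 3 / 2 :> R.
Proof. by rewrite -mulrA sin_mulr2 cos_pi3 sin_pi3; field. Qed.

(** Partial fractions: x^3 + 1 = (x + 1) (x^2 - x + 1), where (x + 1)^2 is [quad] at angle 0 and x^2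
    - x + 1 is [quad] at angle 2 pi / 3. The two logarithms cancel at infinity and only the
    arctangent contributes. *)
Lemma log_primitive_cubic :
  log_primitive (fun x => x / (x ^+ 3 + 1)) 0 (2 * pi / (3 * Num.sqrt 3)).
Proof.
have pi0 := @pi_gt0 R.
have h0 : 0 <= (0:R) < pi by rewrite lexx.
have h1 : 0 < (2 * pi / 3 : R) < pi by lra.
have h1' : 0 <= (2 * pi / 3 : R) < pi by lra.
have w0 : (0:R) < Num.sqrt 3 by rewrite sqrtr_gt0.
have w2 : Num.sqrt 3 ^+ 2 = 3 :> R by rewrite sqr_sqrtr.
have L0 := log_primitiveZ (- 6^-1) (log_primitive_log h0).
have L1 := log_primitiveZ (6^-1) (log_primitive_log h1').
have A1 := log_primitiveZ ((Num.sqrt 3)^-1) (log_primitive_atan h1).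
have := log_primitiveD (log_primitiveD L0 L1) A1.
have -> : - 6^-1 * 2 + 6^-1 * 2 + (Num.sqrt 3)^-1 * 0 = 0 :> R by ring.
have -> : - 6^-1 * 0 + 6^-1 * 0 + (Num.sqrt 3)^-1 * (2 * pi / 3) =
  2 * pi / (3 * Num.sqrt 3) :> R by field; rewrite gt_eqF.
move=> /log_primitive_ext; apply => x x1.
have := quad_gt0 h0 x1; have := quad_gt0 h1' x1.
rewrite /quad cos0 cos_2pi3 sin_2pi3 => q1 q0.
have e : x ^+ 3 + 1 = (x + 1) * (x ^+ 2 + 2 * - 2^-1 * x + 1) by field.
have e' : x ^+ 2 + 2 * 1 * x + 1 = (x + 1) ^+ 2 by ring.
rewrite e e'; field.
have q0' : 0 < (x + 1) by lra.
have {}q1 : 0 < x ^+ 2 + -1 * x + 1.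
  by apply: lt_le_trans q1 _; rewrite mulrN mulfV.
by rewrite !gt_eqF.
Qed.

(** Write x + 1 = (x + cos g) + (1 - cos g) with 1 - cos g = tan (g / 2) sin g. These are the
    fractions into which the angle kernel decomposes. *)
Lemma log_primitive_tan {g} : 0 < g < pi ->
  log_primitive (fun x => (x + 1) / quad g x) 1 (tan (g / 2) * g).
Proof.
move=> gpi; have /andP[g0 gp] := gpi.
have g1 : 0 <= g < pi by rewrite ltW.
have sg : 0 < sin g by rewrite sin_gt0_pi// g0.
have t : tan (g / 2) = (1 - cos g) / sin g.
  have c0 : 0 < cos (g / 2) by rewrite cos_gt0_pihalf//; lra.
  have -> : sin g = 2 * (sin (g / 2) * cos (g / 2)).
    by rewrite -sin_mulr2 mulrC divfK.
  have -> : cos g = 2 * cos (g / 2) ^+ 2 - 1.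
    by rewrite -cos_mulr2 [2 * _]mulrC divfK.
  have s0 : 0 < sin (g / 2) by rewrite sin_gt0_pi//; lra.
  rewrite /tan; have s2 := sin2cos2 (g / 2).
  have -> : 1 - (2 * cos (g / 2) ^+ 2 - 1) = 2 * sin (g / 2) ^+ 2.
    by rewrite s2; ring.
  by field; rewrite !gt_eqF.
have := log_primitiveD (log_primitiveZ 2^-1 (log_primitive_log g1))
  (log_primitiveZ (tan (g / 2)) (log_primitive_atan gpi)).
rewrite !mulr0 addr0 add0r mulVf//.
move=> /log_primitive_ext; apply => x x1.
have q0 := quad_gt0 g1 x1.
by rewrite t; field; rewrite !gt_eqF.
Qed.

Lemma cubeD1_gt0 {x} : -1 < x -> 0 < x ^+ 3 + 1.
Proof.
move=> x1; have -> : x ^+ 3 + 1 = (x + 1) * quad (2 * pi / 3) x.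
  by rewrite /quad cos_2pi3; field.
have pi0 := @pi_gt0 R.
by rewrite mulr_gt0 ?quad_gt0//; lra.
Qed.

Lemma quad_double g x : quad (2 * g) x = (x - 1) ^+ 2 + 4 * cos g ^+ 2 * x.
Proof. by rewrite /quad cos_mulr2; ring. Qed.

(* [2 * (d + pi / 3)] and [2 * (pi / 3 - d)] have the same cosines as
   [2 * d + 2 * pi / 3] and [2 * d - 2 * pi / 3]: these are the factors attached
   to the three cube roots of [- exp (6 i d)]. *)
Lemma quad_triple d x (c := cos d) (c1 := cos (d + pi / 3))
    (c2 := cos (pi / 3 - d)) (q0 := quad (2 * d) x)
    (q1 := quad (2 * (d + pi / 3)) x) (q2 := quad (2 * (pi / 3 - d)) x) :
  q0 * q1 * q2 = quad (6 * d) (x ^+ 3) /\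
  c * (q1 * q2) - c1 * (q0 * q2) - c2 * (q0 * q1) =
    - 3 * cos (3 * d) * x * (x ^+ 2 - x + 1).
Proof.
rewrite {}/q0 {}/q1 {}/q2 !quad_double.
have -> : 6 * d = 2 * (3 * d) by ring.
rewrite quad_double cos_mulr3 -/c -/c1 -/c2.
have w2 : Num.sqrt 3 ^+ 2 = 3 :> R by rewrite sqr_sqrtr.
have := sin2cos2 d; rewrite -/c => s2.
have -> : c1 = c / 2 - sin d * Num.sqrt 3 / 2.
  by rewrite /c1 cosD cos_pi3 sin_pi3 -/c; ring.
have -> : c2 = c / 2 + sin d * Num.sqrt 3 / 2.
  by rewrite /c2 cosB cos_pi3 sin_pi3 -/c; ring.
(* Now c1 = (c - t) / 2 and c2 = (c + t) / 2, so both claims are polynomial identities in c, t and x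
   modulo t^2 = 3 (1 - c^2). *)
set t := sin d * Num.sqrt 3.
have t2 : t ^+ 2 = 3 * (1 - c ^+ 2) by rewrite exprMn w2 s2; ring.
by split; field: t2.
Qed.

(** This kernel is x / (x^3 + 1) times the b-derivative of - ln (quad b (x^3)); the next one is x /
    (x^3 + 1) times the s-derivative of ln (s^3 x^3 + 1). *)
Definition angle_kernel b x :=
  2 * sin b * x ^+ 4 / ((x ^+ 3 + 1) * quad b (x ^+ 3)).

Definition scale_kernel s x :=
  3 * s ^+ 2 * x ^+ 4 / ((x ^+ 3 + 1) * (s ^+ 3 * x ^+ 3 + 1)).

Lemma angle_kernel_ge0 b x : 0 < b < pi -> 0 <= x -> 0 <= angle_kernel b x.
Proof.
move=> b0 x0.
have x1 : -1 < x ^+ 3 by apply: lt_le_trans (exprn_ge0 _ x0).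
have b1 : 0 <= b < pi by lra.
apply: divr_ge0.
  by rewrite !mulr_ge0 ?exprn_ge0// ltW// sin_gt0_pi.
by rewrite mulr_ge0 ?ltW ?quad_gt0//; lra.
Qed.

Lemma scale_kernel_ge0 s x : 0 <= s -> 0 <= x -> 0 <= scale_kernel s x.
Proof.
move=> s0 x0; apply: divr_ge0; rewrite !mulr_ge0 ?exprn_ge0//.
  by rewrite addr_ge0 ?exprn_ge0.
by rewrite addr_ge0 ?mulr_ge0 ?exprn_ge0.
Qed.

(** Put b = 6 d. As (x^3 + 1)^2 - quad b (x^3) = 4 (sin 3d)^2 x^3, the kernel is cot (3d) times x
    (x^3 + 1) / quad b (x^3) - x / (x^3 + 1). By [quad_triple] the first fraction splits into
    multiples of (x + 1) / q for three quadratics q. *)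
Lemma integral_angle_kernel b : 0 < b < pi ->
  (\int[lebesgue_measure]_(x in `[0%R, +oo[) (angle_kernel b x)%:E =
  (4 * pi / (3 * Num.sqrt 3) * (sin (b / 3) / (1 + 2 * cos (b / 3))))%:E)%E.
Proof.
move=> /andP[b0 bpi].
have pi0 := @pi_gt0 R.
have w0 : (0:R) < Num.sqrt 3 by rewrite sqrtr_gt0.
pose d := b / 6; have bd : b = 6 * d by rewrite mulrC divfK.
have h0 : 0 < 2 * d < pi by rewrite /d; lra.
have h1 : 0 < 2 * (d + pi / 3) < pi by rewrite /d; lra.
have h2 : 0 < 2 * (pi / 3 - d) < pi by rewrite /d; lra.
have c0 : 0 < cos d by rewrite cos_gt0_pihalf// /d; lra.
have c1 : 0 < cos (d + pi / 3) by rewrite cos_gt0_pihalf// /d; lra.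
have c2 : 0 < cos (pi / 3 - d) by rewrite cos_gt0_pihalf// /d; lra.
have s0 : 0 < sin d by rewrite sin_gt0_pi// /d; lra.
have D0 : 0 < sin (3 * d) by rewrite sin_gt0_pi// /d; lra.
have sb : sin b = 2 * (sin (3 * d) * cos (3 * d)).
  by rewrite -sin_mulr2 bd; congr sin; ring.
apply: integral_log_primitive.
  by move=> x x0; rewrite angle_kernel_ge0// b0.
have L0 := log_primitiveZ (cos d) (log_primitive_tan h0).
have L1 := log_primitiveZ (- cos (d + pi / 3)) (log_primitive_tan h1).
have L2 := log_primitiveZ (- cos (pi / 3 - d)) (log_primitive_tan h2).
have L3 := log_primitiveZ (- (cos (3 * d) / sin (3 * d))) log_primitive_cubic.
have := log_primitiveD (log_primitiveZ (- (3 * sin (3 * d))^-1)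
  (log_primitiveD (log_primitiveD L0 L1) L2)) L3.
(* The logarithmic divergences cancel: cos d - cos (d + pi / 3) - cos (pi / 3 - d) = 0. *)
set a := (X in log_primitive _ X _); have -> : a = 0.
  by rewrite /a !mulr1 cosD cosB cos_pi3; field; rewrite gt_eqF.
set v := (X in log_primitive _ _ X); move: @v.
have -> : 2 * d / 2 = d by field.
have -> : 2 * (d + pi / 3) / 2 = d + pi / 3 by field.
have -> : 2 * (pi / 3 - d) / 2 = pi / 3 - d by field.
move=> v; have -> : v = 4 * pi / (3 * Num.sqrt 3) *
    (sin (b / 3) / (1 + 2 * cos (b / 3))).
  have -> : b / 3 = 2 * d by rewrite bd; field.
  have e4 : 1 + 2 * cos (2 * d) = 4 * cos d ^+ 2 - 1 by rewrite cos_mulr2; ring.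
  have e3 : sin (3 * d) = sin d * (4 * cos d ^+ 2 - 1).
    by rewrite sin_mulr3; have s2 := sin2cos2 d; ring: s2.
  have p4 : 0 < 4 * cos d ^+ 2 - 1 by rewrite -(pmulr_rgt0 _ s0) -e3.
  have ct g : 0 < cos g -> cos g * tan g = sin g.
    by move=> cg; rewrite /tan mulrC divfK// gt_eqF.
  have -> : v = - (3 * sin (3 * d))^-1 * (sin d * (2 * d)
      - sin (d + pi / 3) * (2 * (d + pi / 3))
      - sin (pi / 3 - d) * (2 * (pi / 3 - d)))
      - cos (3 * d) / sin (3 * d) * (2 * pi / (3 * Num.sqrt 3)).
    by rewrite /v -(ct _ c0) -(ct _ c1) -(ct _ c2); ring.
  (* The terms with d outside a sine or cosine cancel, which leaves 2 pi / (3 sqrt 3) times (cos d -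
     cos 3d) / sin 3d, and cos d - cos 3d = 2 sin 2d sin d. *)
  rewrite e4 e3 sin_mulr2 cos_mulr3 sinB sinD cos_pi3 sin_pi3.
  have s2 := sin2cos2 d.
  have w2 : Num.sqrt 3 ^+ 2 = 3 :> R by rewrite sqr_sqrtr.
  by field: s2 w2; rewrite !gt_eqF.
move=> /log_primitive_ext; apply => x x1.
have [] := quad_triple d x.
have := quad_gt0 (ltW_itv h0) x1; have := quad_gt0 (ltW_itv h1) x1.
have := quad_gt0 (ltW_itv h2) x1.
set q0 := quad (2 * d) x; set q1 := quad (2 * (d + pi / 3)) x.
set q2 := quad (2 * (pi / 3 - d)) x => q2p q1p q0p Q S.
have -> : cos d * ((x + 1) / q0) + - cos (d + pi / 3) * ((x + 1) / q1) +
    - cos (pi / 3 - d) * ((x + 1) / q2) =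
    (x + 1) * (- 3 * cos (3 * d) * x * (x ^+ 2 - x + 1)) / quad b (x ^+ 3).
  by rewrite -S bd -Q; field; rewrite !gt_eqF.
have Qp : 0 < quad b (x ^+ 3) by rewrite bd -Q !mulr_gt0.
have Qe : quad b (x ^+ 3) = (x ^+ 3 - 1) ^+ 2 + 4 * cos (3 * d) ^+ 2 * x ^+ 3.
  by rewrite -quad_double bd; congr quad; ring.
have x3 := cubeD1_gt0 x1.
have s2 := sin2cos2 (3 * d).
rewrite /angle_kernel sb Qe; rewrite Qe in Qp.
by field: s2; rewrite !gt_eqF.
Qed.

(** Partial fractions in x^3: the kernel is 3 s^2 x / (1 - s^3) times 1 / (s^3 x^3 + 1) - 1 / (x^3 +
    1), so both pieces reduce to x / (x^3 + 1), one of them dilated by s. *)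
Lemma integral_scale_kernel s : 0 < s < 1 ->
  (\int[lebesgue_measure]_(x in `[0%R, +oo[) (scale_kernel s x)%:E =
  (2 * pi / Num.sqrt 3 * ((s + 1) / (s ^+ 2 + s + 1)))%:E)%E.
Proof.
move=> /andP[s0 s1].
have w0 : (0:R) < Num.sqrt 3 by rewrite sqrtr_gt0.
have s3 : 0 < s ^+ 2 + s + 1 by rewrite !addr_gt0// exprn_gt0.
have s4 : 0 < 1 - s by rewrite subr_gt0.
apply: integral_log_primitive.
  by move=> x x0; rewrite scale_kernel_ge0// ltW.
have s01 : 0 < s <= 1 by rewrite s0 ltW.
have L0 := log_primitiveZ (3 / (1 - s ^+ 3))
  (log_primitive_dilate s01 log_primitive_cubic).
have L1 := log_primitiveZ (- (3 * s ^+ 2 / (1 - s ^+ 3))) log_primitive_cubic.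
have := log_primitiveD L0 L1.
have e3 : 1 - s ^+ 3 = (1 - s) * (s ^+ 2 + s + 1) by ring.
rewrite !mulr0 addr0.
set v := (X in log_primitive _ _ X).
have -> : v = 2 * pi / Num.sqrt 3 * ((s + 1) / (s ^+ 2 + s + 1)).
  by rewrite /v e3; field; rewrite !gt_eqF.
move=> /log_primitive_ext; apply => x x1.
have p1 := cubeD1_gt0 x1.
have p2 : 0 < (s * x) ^+ 3 + 1 by apply: cubeD1_gt0; nra.
rewrite /scale_kernel -exprMn e3.
by field; rewrite !gt_eqF.
Qed.

End primitives.

(** * Iterated integrals *)

Section iterated.
Context {R : realType}.
Implicit Types (f F : R -> R) (a b s v x : R).
Local Notation mu := (@lebesgue_measure R).

(** The interval is open because the integrals of the kernels over x are computed only for interior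
    parameters: their partial fractions divide by 1 - s^3 and by sin (b / 2). *)
Lemma integral_oo_derive F {f a b v} : a < b -> F b - F a = v ->
  (forall x, a <= x <= b -> is_derive x 1 F (f x)) ->
  (forall x, a <= x <= b -> {for x, continuous f}) ->
  (\int[mu]_(x in `]a, b[) (f x)%:E = v%:E)%E.
Proof.
move=> ab <- dF cf.
have cF x : a <= x <= b -> {for x, continuous F}.
  move=> /dF dFx; apply: differentiable_continuous; apply/derivable1_diffP.
  exact: ex_derive.
have cw : {within `[a, b], continuous f}.
  by apply: continuous_in_subspaceT => x; rewrite inE/= in_itv/=; exact: cf.
rewrite -(integral_itv_bndoo true false); last first.
  apply/measurable_EFinP; apply: open_continuous_measurable_fun => //.
  by move=> x; rewrite inE/= in_itv/= => /andP[ax xb]; apply: cf; rewrite !ltW.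
rewrite EFinB; apply: (continuous_FTC2 ab cw).
- split.
  + move=> x; rewrite in_itv/= => /andP[ax xb].
    have xab : a <= x <= b by rewrite !ltW.
    by have := dF _ xab => dFx; exact: ex_derive.
  + by apply: cvg_at_right_filter; apply: cF; rewrite lexx ltW.
  + by apply: cvg_at_left_filter; apply: cF; rewrite lexx ltW.
- move=> x; rewrite in_itv/= => /andP[ax xb].
  have xab : a <= x <= b by rewrite !ltW.
  by rewrite derive1E; have := dF _ xab => dFx; exact: derive_val.
Qed.

(** * Measurability of the kernels and Tonelli's theorem *)

Lemma measurable_inv : measurable_fun setT (fun x : R => x^-1).
Proof.
(* The square makes the base of the real power nonnegative; at 0 both sides are 0, by the convention
   that the inverse of 0 is 0. *)
have -> : (fun x : R => x^-1) = (fun x => x * (x ^+ 2) `^ (-1)).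
  apply/funext => x; rewrite powR_inv1 ?sqr_ge0//.
  have [->|x0] := eqVneq x 0; first by rewrite invr0 mul0r.
  by rewrite expr2 invfM mulrA mulfV// mul1r.
apply: measurable_funM => //.
by apply: (measurableT_comp (measurable_powR _)); exact: measurable_funX.
Qed.

(** Multiplying by the indicators of A and B extends f by zero to a nonnegative measurable function
    on the whole plane, where Tonelli's theorem applies. *)
Lemma tonelli_sets (f : R -> R -> R) (A B : set R) :
  measurable A -> measurable B ->
  measurable_fun setT (fun z : R * R => f z.1 z.2) ->
  (forall x y, A x -> B y -> 0 <= f x y) ->
  (\int[mu]_(x in A) \int[mu]_(y in B) (f x y)%:E =
   \int[mu]_(y in B) \int[mu]_(x in A) (f x y)%:E)%E.
Proof.
move=> mA mB mf f0.
pose h (z : R * R) := (\1_A z.1 * \1_B z.2 * f z.1 z.2)%:E.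
have hE x y : h (x, y) = (\1_A x * \1_B y * f x y)%:E by [].
have mh : measurable_fun setT h.
  apply/measurable_EFinP; apply: measurable_funM => //.
  apply: measurable_funM.
    exact: (measurableT_comp (measurable_indic mA) measurable_fst).
  exact: (measurableT_comp (measurable_indic mB) measurable_snd).
have h0 z : (0 <= h z)%E.
  case: z => x y; rewrite hE lee_fin !indicE.
  case: (boolP (x \in A)) => [|_]; last by rewrite !mul0r.
  case: (boolP (y \in B)) => [|_]; last by rewrite mulr0 mul0r.
  by rewrite !inE !mul1r => By Ax; exact: f0.
transitivity (\int[mu]_x \int[mu]_y h (x, y))%E.
  rewrite integral_mkcond; apply: eq_integral => x _.
  rewrite patchE; case: ifPn => xA.
    rewrite integral_mkcond; apply: eq_integral => y _.
    by rewrite patchE hE !indicE xA mul1r; case: ifPn; rewrite ?mul1r// mul0r.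
  rewrite integral0_eq// => y _.
  by rewrite hE indicE (negbTE xA) !mul0r.
rewrite fubini_tonelli//.
rewrite [RHS]integral_mkcond; apply: eq_integral => y _.
rewrite patchE; case: ifPn => yB.
  rewrite [RHS]integral_mkcond; apply: eq_integral => x _.
  by rewrite patchE hE !indicE yB mulr1; case: ifPn; rewrite ?mul1r// mul0r.
rewrite integral0_eq// => x _.
by rewrite hE [\1_B _]indicE (negbTE yB) mulr0 mul0r.
Qed.

Lemma measurable_quad d (T : measurableType d) (g h : T -> R) :
  measurable_fun setT g -> measurable_fun setT h ->
  measurable_fun setT (fun z => quad (g z) (h z)).
Proof.
move=> mg mh; apply: measurable_funD => //.
apply: measurable_funD; first exact: measurable_funX.
apply: measurable_funM => //; apply: measurable_funM => //.
apply: measurableT_comp mg; apply: continuous_measurable_fun.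
exact: continuous_cos.
Qed.

Lemma measurable_angle_kernel :
  measurable_fun setT (fun z : R * R => angle_kernel z.1 z.2).
Proof.
apply: measurable_funM.
  apply: measurable_funM; last exact: measurable_funX.
  apply: measurable_funM => //; apply: measurableT_comp => //.
  by apply: continuous_measurable_fun; exact: continuous_sin.
apply: (measurableT_comp measurable_inv); apply: measurable_funM.
  by apply: measurable_funD => //; exact: measurable_funX.
by apply: measurable_quad => //; exact: measurable_funX.
Qed.

Lemma measurable_scale_kernel :
  measurable_fun setT (fun z : R * R => scale_kernel z.1 z.2).
Proof.
apply: measurable_funM.
  by apply: measurable_funM; [apply: measurable_funM => //|];
    exact: measurable_funX.
apply: (measurableT_comp measurable_inv); apply: measurable_funM.
  by apply: measurable_funD => //; exact: measurable_funX.
by apply: measurable_funD => //; apply: measurable_funM; exact: measurable_funX.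
Qed.

(** * Integrals of the kernels over the parameter, and exchange of the order *)

Lemma integral_scale_kernel_param x : 0 <= x ->
  (\int[mu]_(s in `]0%R, 1%R[) (scale_kernel s x)%:E =
   (x * ln (x ^+ 3 + 1) / (x ^+ 3 + 1))%:E)%E.
Proof.
move=> x0; have x3 : 0 <= x ^+ 3 by rewrite exprn_ge0.
have p s : 0 <= s <= 1 -> 0 < s ^+ 3 * x ^+ 3 + 1.
  by move=> /andP[s0 _]; rewrite ltr_wpDl ?mulr_ge0 ?exprn_ge0.
pose F s := x / (x ^+ 3 + 1) * ln (s ^+ 3 * x ^+ 3 + 1).
apply: (@integral_oo_derive F (scale_kernel^~ x)); first by [].
- by rewrite /F expr1n mul1r expr0n/= mul0r add0r ln1 mulr0 subr0 mulrAC.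
- move=> s /p s1.
  have du : is_derive s 1 (fun t => t ^+ 3 * x ^+ 3 + 1 : R)
      (3 * s ^+ 2 * x ^+ 3).
    by apply: is_derive_eq; rewrite /GRing.scale/=; ring.
  have dl := is_derive1_ln s1.
  have := is_derive1_comp (f := @ln R) (g := fun t => t ^+ 3 * x ^+ 3 + 1) dl du.
  move=> dc; apply: (is_derive_eq (is_deriveZ (x / (x ^+ 3 + 1)) dc)).
  rewrite /GRing.scale/= /scale_kernel; field.
  by rewrite exprMn !gt_eqF// ltr_wpDl.
- move=> s /p s1; apply: cvgM.
    by apply: cvgMl; apply: cvgMr; exact: exprn_continuous.
  apply: cvgV; first by rewrite mulf_neq0// gt_eqF// ltr_wpDl.
  apply: cvgMr; apply: cvgD; last exact: cvg_cst.
  by apply: cvgMl; exact: exprn_continuous.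
Qed.

Lemma integral_angle_kernel_param a x : 0 < a < pi -> 0 <= x ->
  (\int[mu]_(b in `]0%R, a[) (angle_kernel b x)%:E =
   (x * (2 * ln (x ^+ 3 + 1) - ln (quad a (x ^+ 3))) / (x ^+ 3 + 1))%:E)%E.
Proof.
move=> /andP[a0 api] x0; have x3 : 0 <= x ^+ 3 by rewrite exprn_ge0.
have x31 : -1 < x ^+ 3 by apply: lt_le_trans x3.
have p b : 0 <= b <= a -> 0 < quad b (x ^+ 3).
  by move=> /andP[b0 ba]; rewrite quad_gt0// b0 (le_lt_trans ba).
pose F b := - (x / (x ^+ 3 + 1)) * ln (quad b (x ^+ 3)).
apply: (@integral_oo_derive F (angle_kernel^~ x)); first by [].
- rewrite /F.
  have -> : quad 0 (x ^+ 3) = (x ^+ 3 + 1) ^+ 2 by rewrite /quad cos0; ring.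
  by rewrite lnXn ?ltr_wpDl// -mulr_natl; ring.
- move=> b /p b1.
  have du : is_derive b 1 (fun t => quad t (x ^+ 3) : R) (- (2 * sin b * x ^+ 3)).
    by apply: is_derive_eq; rewrite /GRing.scale/=; ring.
  have dl := is_derive1_ln b1.
  have := is_derive1_comp (f := @ln R) (g := fun t => quad t (x ^+ 3)) dl du.
  move=> dc; apply: (is_derive_eq (is_deriveZ (- (x / (x ^+ 3 + 1))) dc)).
  rewrite /GRing.scale/= /angle_kernel; field.
  by rewrite !gt_eqF// ltr_wpDl.
- move=> b /p b1; apply: cvgM.
    by apply: cvgMl; apply: cvgMr; exact: continuous_sin.
  apply: cvgV; first by rewrite mulf_neq0// gt_eqF// ltr_wpDl.
  apply: cvgMr; apply: cvgD; last exact: cvg_cst.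
  apply: cvgD; first exact: cvg_cst.
  by apply: cvgMl; apply: cvgMr; exact: continuous_cos.
Qed.

(** After the exchange, (s + 1) / (s^2 + s + 1) remains to be integrated over 0 < s < 1. With s + 1
    = (2 s + 1) / 2 + 1 / 2 this gives (ln 3) / 2 plus (pi / 3 - pi / 6) / sqrt 3. *)
Lemma integral_log_base :
  (\int[mu]_(x in `[0%R, +oo[) (x * ln (x ^+ 3 + 1) / (x ^+ 3 + 1))%:E =
   (pi ^+ 2 / 9 + pi * ln 3 / Num.sqrt 3)%:E)%E.
Proof.
transitivity (\int[mu]_(x in `[0%R, +oo[) \int[mu]_(s in `]0%R, 1%R[)
    (scale_kernel s x)%:E)%E.
  apply: eq_integral => x; rewrite inE/= in_itv/= andbT => x0.
  by rewrite integral_scale_kernel_param.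
rewrite -(@tonelli_sets scale_kernel)//; last 2 first.
- exact: measurable_scale_kernel.
- move=> s x /=; rewrite !in_itv/= andbT => /andP[/ltW s0 _].
  exact: scale_kernel_ge0.
under eq_integral.
  move=> s; rewrite inE/= in_itv/= => s01.
  rewrite integral_scale_kernel//; over.
have w0 : (0:R) < Num.sqrt 3 by rewrite sqrtr_gt0.
have w2 : Num.sqrt 3 ^+ 2 = 3 :> R by rewrite sqr_sqrtr.
have pi0 := @pi_gt0 R.
pose F (s : R) := 2 * pi / Num.sqrt 3 *
  (2^-1 * ln (s ^+ 2 + s + 1) +
   (Num.sqrt 3)^-1 * atan ((2 * s + 1) / Num.sqrt 3)).
apply: (@integral_oo_derive F
  (fun s => 2 * pi / Num.sqrt 3 * ((s + 1) / (s ^+ 2 + s + 1)))); first by [].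
- rewrite /F expr1n expr0n/= !add0r mulr0 add0r ln1.
  have -> : (2 * 1 + 1) / Num.sqrt 3 = tan (pi / 3) :> R.
    rewrite /tan sin_pi3 cos_pi3; field: w2; rewrite gt_eqF//.
  have -> : 1 / Num.sqrt 3 = tan (pi / 6) :> R.
    have -> : pi / 6 = pi / 2 - pi / 3 :> R by field.
    rewrite /tan sinB cosB sin_pihalf cos_pihalf sin_pi3 cos_pi3.
    by field: w2; rewrite gt_eqF.
  rewrite !tanK ?in_itv/=; [|lra|lra].
  have -> : 1 + 1 + 1 = 3 :> R by ring.
  by field: w2; rewrite gt_eqF.
- move=> s /andP[s0 s1]; have s3 : 0 < s ^+ 2 + s + 1 by nra.
  have du : is_derive s 1 (fun t => t ^+ 2 + t + 1 : R) (2 * s + 1).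
    by apply: is_derive_eq; rewrite /GRing.scale/=; ring.
  have dl := is_derive1_ln s3.
  have d1 := is_derive1_comp (f := @ln R) (g := fun t => t ^+ 2 + t + 1) dl du.
  have dv : is_derive s 1 (fun t => (2 * t + 1) / Num.sqrt 3 : R)
      (2 / Num.sqrt 3).
    by apply: is_derive_eq; rewrite /GRing.scale/=; ring.
  have d2 := is_derive1_comp (f := @atan R)
    (g := fun t => (2 * t + 1) / Num.sqrt 3)
    (is_derive1_atan _) dv.
  apply: (is_derive_eq (is_deriveZ (2 * pi / Num.sqrt 3)
    (is_deriveD (is_deriveZ (2^-1) d1) (is_deriveZ ((Num.sqrt 3)^-1) d2)))).
  rewrite /GRing.scale/= exprMn exprVn w2.
  by field: w2; rewrite !gt_eqF// ltr_wpDr ?sqr_ge0.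
- move=> s /andP[s0 s1]; apply: cvgMr; apply: cvgM.
    by apply: cvgD; [exact: cvg_id|exact: cvg_cst].
  apply: cvgV; first by rewrite gt_eqF//; nra.
  apply: cvgD; last exact: cvg_cst.
  by apply: cvgD; [exact: exprn_continuous|exact: cvg_id].
Qed.

(** After the exchange the integrand in b is, up to a constant, the logarithmic derivative of 1 + 2
    cos (b / 3), which equals 3 at b = 0 and stays positive because b / 3 < pi / 2. *)
Lemma integral_log_defect {a} : 0 < a < pi ->
  (\int[mu]_(x in `[0%R, +oo[)
     (x * (2 * ln (x ^+ 3 + 1) - ln (quad a (x ^+ 3))) / (x ^+ 3 + 1))%:E =
   (2 * pi / Num.sqrt 3 * (ln 3 - ln (1 + 2 * cos (a / 3))))%:E)%E.
Proof.
move=> api; have /andP[a0 ap] := api.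
transitivity (\int[mu]_(x in `[0%R, +oo[) \int[mu]_(b in `]0%R, a[)
    (angle_kernel b x)%:E)%E.
  apply: eq_integral => x; rewrite inE/= in_itv/= andbT => x0.
  by rewrite integral_angle_kernel_param.
have ba b : 0 < b < a -> 0 < b < pi.
  by move=> /andP[-> /=] /lt_trans; apply.
rewrite -(@tonelli_sets angle_kernel)//; last 2 first.
- exact: measurable_angle_kernel.
- by move=> b x /=; rewrite !in_itv/= andbT => /ba b0; exact: angle_kernel_ge0.
under eq_integral.
  move=> b; rewrite inE/= in_itv/= => /ba b0.
  rewrite integral_angle_kernel//; over.
have w0 : (0:R) < Num.sqrt 3 by rewrite sqrtr_gt0.
have pi0 := @pi_gt0 R.
have p b : 0 <= b <= a -> 0 < 1 + 2 * cos (b / 3).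
  move=> b0; have /cos_gt0_pihalf : - (pi / 2) < b / 3 < pi / 2 by lra.
  by lra.
pose F (b : R) := - (2 * pi / Num.sqrt 3) * ln (1 + 2 * cos (b / 3)).
apply: (@integral_oo_derive F (fun b => 4 * pi / (3 * Num.sqrt 3) *
  (sin (b / 3) / (1 + 2 * cos (b / 3))))); first by [].
- rewrite /F mul0r cos0.
  have -> : 1 + 2 * 1 = 3 :> R by ring.
  by ring.
- move=> b /p b1.
  have du : is_derive b 1 (fun t => 1 + 2 * cos (t / 3) : R)
      (- (2 / 3 * sin (b / 3))).
    have dt : is_derive b 1 (fun t => t / 3 : R) (3^-1).
      by apply: is_derive_eq; rewrite /GRing.scale/=; ring.
    have dc := is_derive1_comp (f := @cos R) (g := fun t => t / 3)
      (is_derive_cos _) dt.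
    apply: (is_derive_eq (is_deriveD (is_derive_cst (1 : R) b 1)
      (is_deriveZ 2 dc))).
    by rewrite /GRing.scale/=; ring.
  have dl := is_derive1_ln b1.
  have dc := is_derive1_comp (f := @ln R)
    (g := fun t => 1 + 2 * cos (t / 3)) dl du.
  apply: (is_derive_eq (is_deriveZ (- (2 * pi / Num.sqrt 3)) dc)).
  by rewrite /GRing.scale/=; field; rewrite !gt_eqF.
- have c3 : continuous (fun t : R => t / 3).
    by move=> t; apply: cvgMl; exact: cvg_id.
  move=> b /p b1; apply: cvgMr; apply: cvgM.
    by apply: continuous_comp; [exact: c3|exact: continuous_sin].
  apply: cvgV; first by rewrite gt_eqF.
  apply: cvgD; first exact: cvg_cst; apply: cvgMr.
  by apply: continuous_comp; [exact: c3|exact: continuous_cos].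
Qed.

End iterated.

(** * Factorization of [y ^+ m + 1] *)

Module RootsOfMinusOne.
From mathcomp.real_closed Require Import complex.

Section roots.
Context {R : realType}.
Implicit Types (t x y : R) (m k n : nat).
Local Open Scope complex_scope.

Definition cis t : R[i] := cos t +i* sin t.

Lemma cisX t n : cis t ^+ n = cis (n%:R * t).
Proof.
elim: n => [|n IHn]; first by rewrite expr0 mul0r /cis cos0 sin0.
rewrite exprS IHn -natr1 mulrDl mul1r /cis cosD sinD.
by apply/eqP; rewrite eq_complex/=; apply/andP; split; apply/eqP; ring.
Qed.

Lemma cis_oddpi n : cis ((2 * n + 1)%:R * pi) = -1.
Proof.
have -> : (2 * n + 1)%:R * pi = pi + pi *+ 2 *+ n :> R.
  by rewrite -[_ *+ n]mulr_natr -[pi *+ 2]mulr_natr natrD natrM; ring.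
rewrite /cis (periodicn (@cosD2pi R)) (periodicn (@sinD2pi R)) cospi sinpi.
by apply/eqP; rewrite eq_complex/= oppr0 !eqxx.
Qed.

(** Equal points give cos (t2 - t1) = 1, hence sin ((t2 - t1) / 2) = 0; this is impossible if the
    half difference lies strictly between 0 and pi. *)
Lemma cis_inj {t1 t2} : 0 <= t1 < 2 * pi -> 0 <= t2 < 2 * pi ->
  cis t1 = cis t2 -> t1 = t2.
Proof.
wlog t12 : t1 t2 / t1 <= t2.
  move=> W h1 h2 e; have [le|/ltW le] := leP t1 t2; first exact: W.
  by apply/esym/W.
move=> h1 h2 [ec es].
move: t12; rewrite le_eqVlt => /predU1P[//|lt12].
have c1 : cos (t2 - t1) = 1.
  by rewrite cosB ec es -!expr2 cos2Dsin2.
have s0 : 0 < sin ((t2 - t1) / 2) by rewrite sin_gt0_pi//; lra.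
have := cos_mulr2 ((t2 - t1) / 2); rewrite mulrC divfK// c1 cos2sin2 => e.
by nra.
Qed.

(* Each complex root [z] of [y ^+ m + 1] contributes (y - z) (y - conj z). *)
Lemma prod_roots m y : (0 < m)%N ->
  (y ^+ m + 1) ^+ 2 = \prod_(0 <= k < m)
    (y ^+ 2 - 2 * cos ((2 * k + 1)%:R * pi / m%:R) * y + 1).
Proof.
move=> m0.
pose th k : R := (2 * k + 1)%:R * pi / m%:R.
pose zs := [seq cis (th k) | k <- iota 0 m].
have pi0 := @pi_gt0 R.
have m0' : 0 < m%:R :> R by rewrite ltr0n.
have th0 k : (k < m)%N -> 0 <= th k < 2 * pi.
  move=> km; rewrite divr_ge0 ?mulr_ge0 ?ler0n ?ltW//=.
  rewrite ltr_pdivrMr// mulrAC ltr_pM2r//.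
  rewrite -natrM ltr_nat; lia.
have thm k : m%:R * th k = (2 * k + 1)%:R * pi.
  by rewrite mulrC divfK// gt_eqF.
pose P : {poly R[i]} := 'X^m + 1.
have sP : size P = m.+1 by rewrite size_XnaddC.
have lP : lead_coef P = 1.
  by rewrite lead_coefDl ?lead_coefXn// size_polyXn size_poly1.
(* The m points are distinct roots of a monic polynomial of degree m, so it splits over them. *)
have : P = lead_coef P *: \prod_(z <- zs) ('X - z%:P).
  apply: all_roots_prod_XsubC.
  - by rewrite sP size_map size_iota.
  - apply/allP => z /mapP[k _ ->]; rewrite /root /P !hornerE cisX thm.
    by rewrite cis_oddpi addNr.
  - rewrite uniq_rootsE map_inj_in_uniq ?iota_uniq// => j k.
    rewrite !mem_iota !add0n/= => jm km /(cis_inj (th0 _ jm) (th0 _ km)).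
    move/(divIf (lt0r_neq0 m0'))/(mulIf (lt0r_neq0 pi0))/eqP.
    by rewrite eqr_nat => /eqP; lia.
rewrite lP scale1r => /(congr1 (fun p : {poly R[i]} => p.[y%:C])).
rewrite /P horner_prod !hornerE -rmorphXn/= big_map => e.
have e' : (y ^+ m)%:C + 1 = \prod_(0 <= k < m) (y%:C - cis (th k)).
  by rewrite e /index_iota subn0; apply: eq_bigr => k _; rewrite !hornerE.
(* As y is real, the left side is its own conjugate; conjugating the factorization yields the
   factors with the conjugate roots. *)
have ec : (y ^+ m)%:C + 1 = \prod_(0 <= k < m) (y%:C - (cis (th k))^*).
  transitivity (((y ^+ m)%:C + 1)^*).
    by apply/eqP; rewrite eq_complex/= !addr0 oppr0 !eqxx.
  rewrite e' rmorph_prod/=; apply: eq_bigr => k _.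
  by apply/eqP; rewrite eq_complex/= !sub0r opprK !eqxx.
apply: (@complexI R).
rewrite rmorphXn/= rmorphD/= rmorph1 expr2 {1}e' ec -big_split/= rmorph_prod/=.
apply: eq_bigr => k _; rewrite -/(th k).
apply/eqP; rewrite eq_complex/=; apply/andP; split; apply/eqP.
  by have cs := sin2cos2 (th k); ring: cs.
by ring.
Qed.

End roots.
End RootsOfMinusOne.

(** * Summation over the roots *)

Section summation.
Context {R : realType}.
Implicit Types (f h : R -> R) (a t v x y : R) (m k : nat).
Local Notation mu := (@lebesgue_measure R).
Local Notation D := (`[0%R, +oo[%classic : set R).

(** The reflection k -> m - 1 - k carries the lower half of the range onto the upper half; for odd m
    it fixes the middle index [m./2]. *)
Lemma big_nat_reflect (h : nat -> R) m :
  (forall k, (k < m)%N -> h (m.-1 - k)%N = h k) ->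
  \sum_(0 <= k < m) h k = 2 * \sum_(0 <= k < m./2) h k + (odd m)%:R * h m./2.
Proof.
move=> hE.
have m2 : (m./2 <= m)%N by rewrite -[leqRHS]odd_double_half; lia.
rewrite (big_cat_nat (leq0n _) m2)/= mulr2n mulrDl !mul1r -addrA; congr +%R.
have m1 : (m - m./2 = odd m + m./2)%N.
  by rewrite -[X in (X - _)%N]odd_double_half; lia.
rewrite -{1}[m./2]add0n big_addn m1 addrC.
rewrite (big_cat_nat (leq0n _) (leq_addr m./2 (odd m)))/=; congr +%R.
  case: (odd m); last by rewrite big_nil mul0r.
  by rewrite big_nat1 mul1r.
rewrite -[X in index_iota X]add0n big_addn addnC addnK big_nat_rev/= add0n.
rewrite big_nat [RHS]big_nat; apply: eq_bigr => k /= km.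
rewrite -[RHS]hE; last by lia.
by congr h; rewrite -[in RHS](odd_double_half m); lia.
Qed.

(** Since 2 (m - 1 - k) + 1 = 2 m - (2 k + 1), the two angles add up to 2 pi. *)
Lemma varphi_reflect m k : (k < m)%N -> varphi R m (m.-1 - k) = varphi R m k.
Proof.
move=> km; have m0 : m%:R != 0 :> R by rewrite pnatr_eq0; lia.
rewrite /varphi.
have -> : ((2 * (m.-1 - k) + 1) = m + m - (2 * k + 1))%N by lia.
rewrite natrB; last by lia.
rewrite natrD mulrBl mulrBl mulrDl mulrDl mulrAC mulfV// mul1r.
rewrite -[RHS]cosN -(cosD2pi (- _)) addrC mulr2n.
by [].
Qed.

Lemma varphi_half m : odd m -> varphi R m m./2 = -1.
Proof.
move=> om; have m0 : m%:R != 0 :> R by rewrite pnatr_eq0; case: m om.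
rewrite /varphi -cospi; congr cos.
have -> : (2 * m./2 + 1 = m)%N by rewrite -[RHS]odd_double_half om; lia.
by rewrite mulrAC mulfV// mul1r.
Qed.

(** The supplement changes the sign of the cosine, so that y^2 - 2 phi_k y + 1 becomes [quad] at
    this angle. *)
Definition angle m k : R := pi - (2 * k + 1)%:R * pi / m%:R.

Lemma angle_itv {m k} : (k < m./2)%N -> 0 < angle m k < pi.
Proof.
move=> km; have pi0 := @pi_gt0 R.
have m0 : 0 < m%:R :> R by rewrite ltr0n; case: m km.
rewrite /angle subr_gt0 gtrBl ltr_pdivrMr// [pi * _]mulrC ltr_pM2r// ltr_nat.
rewrite divr_gt0 ?mulr_gt0 ?ltr0n ?addn1//=.
  by have := odd_double_half m; lia.
by case: m km {m0}.
Qed.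

(** For k in the upper half the angle can be negative. As the cosine is even, this bound still makes
    each of the m quadratic factors positive. *)
Lemma norm_angle_lt m k : (k < m)%N -> `|angle m k| < pi.
Proof.
move=> km; have pi0 := @pi_gt0 R.
have m0 : 0 < m%:R :> R by rewrite ltr0n; case: m km.
rewrite ltr_norml /angle; apply/andP; split.
  rewrite ltrBrDl -ltrBrDr opprK ltr_pdivrMr//.
  have -> : (pi + pi) * m%:R = (2 * m)%:R * pi :> R by rewrite natrM; ring.
  by rewrite ltr_pM2r// ltr_nat; lia.
rewrite gtrBl divr_gt0 ?mulr_gt0 ?ltr0n ?addn1//; by case: m km {m0}.
Qed.

Lemma cos_angle m k : cos (angle m k) = - varphi R m k.
Proof. by rewrite /angle cosB cospi sinpi mulN1r mul0r addr0. Qed.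

(** Take logarithms in [prod_roots] and halve. Reflected indices give equal factors; for odd m the
    middle factor is (y + 1)^2. *)
Lemma ln_expD1 m y : (0 < m)%N -> 0 <= y ->
  ln (y ^+ m + 1) =
    \sum_(0 <= k < m./2) ln (quad (angle m k) y) + (odd m)%:R * ln (y + 1).
Proof.
move=> m0 y0; have y1 : -1 < y by apply: lt_le_trans y0.
have p0 : 0 < y ^+ m + 1 by rewrite ltr_wpDl ?exprn_ge0.
pose g k := ln (y ^+ 2 - 2 * varphi R m k * y + 1).
have gE k : (k < m./2)%N -> g k = ln (quad (angle m k) y).
  by move=> _; rewrite /g /quad cos_angle; congr ln; ring.
have gh : odd m -> g m./2 = 2 * ln (y + 1).
  move=> om; rewrite /g varphi_half//.
  have -> : y ^+ 2 - 2 * -1 * y + 1 = (y + 1) ^+ 2 by ring.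
  by rewrite lnXn ?ltr_wpDl// mulr_natl.
have : 2 * ln (y ^+ m + 1) = \sum_(0 <= k < m) g k.
  rewrite mulr_natl -lnXn// RootsOfMinusOne.prod_roots//.
  rewrite big_nat [RHS]big_nat.
  (* Positivity of the partial products is carried through the induction, since it is what lets the
     logarithm split. *)
  suff [] : 0 < \prod_(0 <= k < m | (0 <= k < m)%N)
      (y ^+ 2 - 2 * cos ((2 * k + 1)%:R * pi / m%:R) * y + 1) /\
    ln (\prod_(0 <= k < m | (0 <= k < m)%N)
      (y ^+ 2 - 2 * cos ((2 * k + 1)%:R * pi / m%:R) * y + 1)) =
    \sum_(0 <= k < m | (0 <= k < m)%N) g k by [].
  apply: (big_ind2 (fun u v => 0 < u /\ ln u = v)).
  - by rewrite ln1.
  - by move=> u1 v1 u2 v2 [u1p <-] [u2p <-]; rewrite mulr_gt0// lnM ?posrE.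
  - move=> k /= km; split => //; rewrite -/(varphi R m k).
    have g0 : 0 <= `|angle m k| < pi by rewrite normr_ge0 norm_angle_lt.
    have := quad_gt0 g0 y1; rewrite /quad cos_norm cos_angle.
    by rewrite mulrN mulNr.
rewrite big_nat_reflect => [e|k km]; last by rewrite /g varphi_reflect.
have /(mulfI _) -> // : 2 * ln (y ^+ m + 1) =
  2 * (\sum_(0 <= k < m./2) ln (quad (angle m k) y) + (odd m)%:R * ln (y + 1)).
  rewrite e mulrDr; congr +%R.
    by congr (2 * _); rewrite big_nat [RHS]big_nat; apply: eq_bigr => k /= /gE.
  by case: (boolP (odd m)) => [/gh->|_]; rewrite ?mul1r ?mul0r ?mulr0.
Qed.

(** With t the angle, (phi_k + 1) / 2 = (sin (t / 2))^2, so the arcsine is t / 2. Then sin (t / 2) =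
    sin (t / 6) (1 + 2 cos (t / 3)), and ln (sin (t / 6)) cancels. *)
Lemma summandE m k : (k < m./2)%N ->
  summand R m k = ln 2 + 3 * ln (1 + 2 * cos (angle m k / 3)).
Proof.
move=> km; have /andP[a0 api] := angle_itv km.
set t := angle m k in a0 api *; have pi0 := @pi_gt0 R.
have phiE : varphi R m k = - cos t by rewrite /t cos_angle opprK.
rewrite /summand phiE.
have h0 : 0 < sin (t / 2) by rewrite sin_gt0_pi//; lra.
have c1 : - cos t + 1 = 2 * sin (t / 2) ^+ 2.
  have -> : t = 2 * (t / 2) by field.
  by rewrite cos_mulr2 [2 * _ / 2]mulrC mulKf// cos2sin2; ring.
have -> : asin (Num.sqrt ((- cos t + 1) / 2)) = t / 2.
  rewrite c1 mulrC mulKf// sqrtr_sqr gtr0_norm// sinK// in_itv/=; lra.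
have -> : 1 / 3 * (t / 2) = t / 6 by field.
have -> : 2 / 3 * (t / 2) = t / 3 by field.
have s6 : 0 < sin (t / 6) by rewrite sin_gt0_pi//; lra.
have c3 : 0 < 1 + 2 * cos (t / 3).
  have /cos_gt0_pihalf : - (pi / 2) < t / 3 < pi / 2 by lra.
  by lra.
have s2 : sin (t / 2) = sin (t / 6) * (1 + 2 * cos (t / 3)).
  have -> : t / 2 = 3 * (t / 6) by field.
  have -> : t / 3 = 2 * (t / 6) by field.
  by rewrite sin_mulr3 cos_mulr2 cos2sin2; ring.
rewrite c1 s2 [2 * cos _ + 1]addrC.
rewrite exprMn lnM ?posrE ?mulr_gt0 ?exprn_gt0// lnM ?posrE ?exprn_gt0// !lnXn//.
by rewrite -[_ *+ 2]mulr_natl; ring.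
Qed.

(** Integrability accompanies the value so that linearity is available with negative coefficients
    and for integrands of varying sign. *)
Definition has_integral f v :=
  mu.-integrable D (EFin \o f) /\ (\int[mu]_(x in D) (f x)%:E = v%:E)%E.

Lemma has_integral_ge0 f v : measurable_fun setT f ->
  (forall x, 0 <= x -> 0 <= f x) ->
  (\int[mu]_(x in D) (f x)%:E = v%:E)%E -> has_integral f v.
Proof.
move=> mf f0 fv; split => //; apply/integrableP; split.
  by apply/measurable_EFinP; exact: measurable_funTS.
suff -> : (\int[mu]_(x in D) `|(EFin \o f) x| = v%:E)%E by rewrite ltry.
rewrite -fv; apply: eq_integral => x; rewrite inE/= in_itv/= andbT => x0.
by rewrite /= ger0_norm// f0.
Qed.

Lemma has_integral_ext {f h v} : has_integral f v ->
  (forall x, 0 <= x -> h x = f x) -> has_integral h v.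
Proof.
move=> [If fv] hf.
have e : {in D, forall x, (h x)%:E = (f x)%:E}.
  by move=> x; rewrite inE/= in_itv/= andbT => x0; rewrite hf.
split.
  apply: eq_integrable If => //.
  by move=> x xD; rewrite /= (e x xD).
by rewrite -fv; exact: eq_integral.
Qed.

Lemma has_integralZ c {f v} : has_integral f v ->
  has_integral (fun x => c * f x) (c * v).
Proof.
move=> [If fv]; split.
  exact: (@integrableZl _ _ R mu D (measurable_itv _) c _ If).
under eq_integral do rewrite EFinM.
by rewrite integralZl// fv EFinM.
Qed.

Lemma has_integralD {f1 f2 v1 v2} :
  has_integral f1 v1 -> has_integral f2 v2 ->
  has_integral (fun x => f1 x + f2 x) (v1 + v2).
Proof.
move=> [If1 fv1] [If2 fv2]; split.
  exact: (@integrableD _ _ R mu D (measurable_itv _) _ _ If1 If2).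
by under eq_integral do rewrite EFinD; rewrite integralD// fv1 fv2 EFinD.
Qed.

Lemma has_integral_sum n (f : nat -> R -> R) (v : nat -> R) :
  (forall k, (k < n)%N -> has_integral (f k) (v k)) ->
  has_integral (fun x => \sum_(0 <= k < n) f k x) (\sum_(0 <= k < n) v k).
Proof.
elim: n => [_|n IHn h].
  rewrite big_nil; have e : (\int[mu]_(x in D) (0 : R)%:E = 0%:E)%E.
    by rewrite integral0.
  have h0 : has_integral (fun=> 0) 0 by apply: has_integral_ge0.
  by apply: (has_integral_ext h0) => x _; rewrite big_nil.
rewrite big_nat_recr//=.
apply: (has_integral_ext (has_integralD (IHn _) (h n _))) => // [k kn|x _].
  by apply: h; exact: ltnW.
by rewrite big_nat_recr.
Qed.

Lemma has_integral_ln_cube :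
  has_integral (fun x => x * ln (x ^+ 3 + 1) / (x ^+ 3 + 1))
    (pi ^+ 2 / 9 + pi * ln 3 / Num.sqrt 3).
Proof.
have m3 : measurable_fun setT (fun x : R => x ^+ 3 + 1).
  by apply: measurable_funD => //; exact: measurable_funX.
apply: has_integral_ge0 (integral_log_base).
  apply: measurable_funM; last exact: (measurableT_comp measurable_inv).
  by apply: measurable_funM => //; exact: measurableT_comp.
move=> x x0; have x3 : 0 <= x ^+ 3 by rewrite exprn_ge0.
by rewrite divr_ge0 ?mulr_ge0 ?addr_ge0 ?ln_ge0// lerDr.
Qed.

(** For a > 0, subtract [integral_log_defect] from twice the integral with ln (x^3 + 1): the ln 3
    terms cancel. At a = 0 the quadratic is the square (x^3 + 1)^2. *)
Lemma has_integral_ln_quad {a} : 0 <= a < pi ->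
  has_integral (fun x => x * ln (quad a (x ^+ 3)) / (x ^+ 3 + 1))
    (2 * pi ^+ 2 / 9 + 2 * pi / Num.sqrt 3 * ln (1 + 2 * cos (a / 3))).
Proof.
move=> /andP[]; rewrite le_eqVlt => /predU1P[<- _|a0 api].
  have := has_integralZ 2 has_integral_ln_cube.
  rewrite mul0r cos0 mulr1; have -> : 1 + 2 = 3 :> R by ring.
  set v := 2 * (_ + _); set v' := _ + _.
  have -> : v' = v by rewrite /v /v'; ring.
  move=> /has_integral_ext; apply => x x0.
  have x3 : 0 < x ^+ 3 + 1 by rewrite ltr_wpDl ?exprn_ge0.
  have -> : quad 0 (x ^+ 3) = (x ^+ 3 + 1) ^+ 2 by rewrite /quad cos0; ring.
  by rewrite lnXn// -mulr_natl; ring.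
have api' : 0 < a < pi by rewrite a0.
have m3 : measurable_fun setT (fun x : R => x ^+ 3 + 1).
  by apply: measurable_funD => //; exact: measurable_funX.
have H : has_integral
    (fun x => x * (2 * ln (x ^+ 3 + 1) - ln (quad a (x ^+ 3))) / (x ^+ 3 + 1))
    (2 * pi / Num.sqrt 3 * (ln 3 - ln (1 + 2 * cos (a / 3)))).
  apply: has_integral_ge0; last exact: (integral_log_defect api').
    apply: measurable_funM; last exact: (measurableT_comp measurable_inv).
    apply: measurable_funM => //; apply: measurable_funB.
      by apply: measurable_funM => //; exact: measurableT_comp.
    apply: measurableT_comp => //; apply: measurable_quad.
      exact: measurable_cst.
    exact: measurable_funX.
  move=> x x0; have x3 : 0 <= x ^+ 3 by rewrite exprn_ge0.
  have x31 : -1 < x ^+ 3 by apply: lt_le_trans x3.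
  apply: divr_ge0; last by rewrite addr_ge0.
  apply: mulr_ge0 => //; rewrite subr_ge0 mulr_natl -lnXn ?ltr_wpDl//.
  have q0 : 0 < quad a (x ^+ 3) := quad_gt0 (ltW_itv api') x31.
  have p0 : 0 < x ^+ 3 + 1 by rewrite ltr_wpDl.
  (* The defect is nonnegative because cos a <= 1 gives quad a y <= (y + 1)^2 for y = x^3 >= 0. *)
  rewrite ler_ln ?posrE ?exprn_gt0//.
  by rewrite /quad; have := cos_le1 a; nra.
have := has_integralD (has_integralZ 2 has_integral_ln_cube)
  (has_integralZ (-1) H).
set v := 2 * _ + _; set v' := 2 * _ / _ + _.
have -> : v' = v by rewrite /v /v'; ring.
move=> /has_integral_ext; apply => x x0.
by ring.
Qed.

(** Apply [ln_expD1] at y = x^3 and integrate termwise. By [summandE], each ln (1 + 2 cos (a / 3))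
    is a third of the summand minus ln 2; this produces the ln 2 term. The pi^2 terms add up because
    m = [odd m] + 2 [m./2]. *)
Lemma has_integral_ln_expD1 {m} : (0 < m)%N ->
  has_integral (fun x => x * ln (x ^+ (3 * m) + 1) / (x ^+ 3 + 1))
    (pi ^+ 2 * m%:R / 9 + (odd m)%:R * (pi * ln 3 / Num.sqrt 3)
     - m./2%:R * (2 * pi / (3 * Num.sqrt 3)) * ln 2
     + 2 * pi / (3 * Num.sqrt 3) * \sum_(0 <= k < m./2) summand R m k).
Proof.
move=> m0.
have w0 : (0:R) < Num.sqrt 3 by rewrite sqrtr_gt0.
have := has_integralD
  (@has_integral_sum m./2 _ _
    (fun k km => has_integral_ln_quad (ltW_itv (angle_itv km))))
  (has_integralZ (odd m)%:R has_integral_ln_cube).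
set v := _ + _; set v' := _ + 2 * _ / _ * _.
have -> : v' = v.
  rewrite /v'; have -> : \sum_(0 <= k < m./2) summand R m k =
      \sum_(0 <= k < m./2) (ln 2 + 3 * ln (1 + 2 * cos (angle m k / 3))).
    by apply: eq_big_nat => k /= km; exact: summandE.
  have mE : m%:R = (odd m)%:R + 2 * m./2%:R :> R.
    by rewrite -natrM -natrD mul2n odd_double_half.
  rewrite /v !big_split/= !sumr_const_nat subn0 -!mulr_sumr mE.
  rewrite -[_ *+ m./2]mulr_natr -[ln 2 *+ _]mulr_natr.
  by field; rewrite gt_eqF.
move=> /has_integral_ext; apply => x x0.
rewrite exprM ln_expD1 ?exprn_ge0// mulrDr mulr_sumr mulrDl mulr_suml.
by congr +%R; ring.
Qed.

End summation.

(* The upper summation limits (m-2)/2 (m even) and (m-3)/2 (m odd), both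
   inclusive, amount to k < m./2; for m = 1 the sum is empty. *)
Theorem theorem2p12 (R : realType) :
  (forall m : nat, ~~ odd m -> (2 <= m)%N ->
     (\int[lebesgue_measure]_(x in `[0%R, +oo[%classic)
        (x * ln (x ^+ (3 * m) + 1) / (x ^+ 3 + 1))%:E)%E
     = (pi ^+ 2 * m%:R / 9
        - pi * m%:R * Num.sqrt 3 / 9 * ln 2
        + 2 * pi * Num.sqrt 3 / 9
          * \sum_(0 <= k < m./2) summand R m k : R)%:E)
  /\
  (forall m : nat, odd m -> (1 <= m)%N ->
     (\int[lebesgue_measure]_(x in `[0%R, +oo[%classic)
        (x * ln (x ^+ (3 * m) + 1) / (x ^+ 3 + 1))%:E)%E
     = (pi ^+ 2 * m%:R / 9
        + pi * Num.sqrt 3 / 3 * ln 3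
        - pi * (m%:R - 1) * Num.sqrt 3 / 9 * ln 2
        + 2 * pi * Num.sqrt 3 / 9
          * \sum_(0 <= k < m./2) summand R m k : R)%:E).
Proof.
have w0 : (0:R) < Num.sqrt 3 by rewrite sqrtr_gt0.
have w2 : Num.sqrt 3 ^+ 2 = 3 :> R by rewrite sqr_sqrtr.
(* Both parities share one formula; it remains to put [m./2] = m / 2 or (m - 1) / 2 and 1 / sqrt 3 =
   sqrt 3 / 3. *)
split=> m om m1.
  have m0 : (0 < m)%N by exact: ltnW.
  have [_ ->] := @has_integral_ln_expD1 R m m0; congr EFin.
  have mE : m%:R = 2 * m./2%:R :> R.
    by rewrite -natrM -[in LHS](odd_double_half m) (negbTE om) add0n -mul2n.
  have -> : (odd m)%:R = 0 :> R by rewrite (negbTE om).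
  by rewrite mE; field: w2; rewrite gt_eqF.
have [_ ->] := @has_integral_ln_expD1 R m m1; congr EFin.
have mE : m%:R = 1 + 2 * m./2%:R :> R.
  by rewrite -natrM -[in LHS](odd_double_half m) om natrD -mul2n.
have -> : (odd m)%:R = 1 :> R by rewrite om.
by rewrite mE; field: w2; rewrite gt_eqF.
Qed.
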